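(* Let $\emptyset\ne A\subseteq\widetilde{\mathbb R}^d$ be internal and sharply bounded. Let $u=[(u_\varepsilon)_\varepsilon]\in\widetilde{\mathcal G}(A)$. Let $(A_\varepsilon)_\varepsilon$ be a sharply bounded representative of $A$. The following are equivalent: (1) there exists $v\in\widetilde{\mathcal G}(A)$ such that $uv=1$; (2) for each $\tilde x\in A$, $u(\tilde x)$ is invertible in $\widetilde{\mathbb C}$; (3) there exist $\varepsilon_0\in(0,1)$ and $n\in\mathbb N$ such that for all $\varepsilon\le\varepsilon_0$, $\inf_{x\in A_\varepsilon+\varepsilon^n}|u_\varepsilon(x)|\ge\varepsilon^n$.
   Context: Nets are indexed by $\varepsilon\in(0,1)$; ''for small $\varepsilon$'' means for all $\varepsilon\le\varepsilon_0$ for some $\varepsilon_0\in(0,1)$. For $E=\mathbb C$ or $E=\mathbb R^d$, a net $(x_\varepsilon)_\varepsilon$ in $E$ is moderate ($\in\mathcal M_E$) if there is $N\in\mathbb N$ with $|x_\varepsilon|\le\varepsilon^{-N}$ for small $\varepsilon$, and negligible ($\in\mathcal N_E$) if for each $m\in\mathbb N$, $|x_\varepsilon|\le\varepsilon^m$ for small $\varepsilon$. $\widetilde{\mathbb C}=\mathcal M_{\mathbb C}/\mathcal N_{\mathbb C}$, $\widetilde{\mathbb R}^d=\mathcal M_{\mathbb R^d}/\mathcal N_{\mathbb R^d}$; $[(x_\varepsilon)_\varepsilon]$ is the class of $(x_\varepsilon)_\varepsilon$. For $\tilde x=[(x_\varepsilon)_\varepsilon]$, $\mathrm v(\tilde x)=\sup\{b\in\mathbb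 R:|x_\varepsilon|\le\varepsilon^b\text{ for small }\varepsilon\}$ and $|\tilde x|_{\mathrm e}=e^{-\mathrm v(\tilde x)}$ (sharp norm). $A\subseteq\widetilde{\mathbb R}^d$ is sharply bounded if $\sup_{\tilde x\in A}|\tilde x|_{\mathrm e}<\infty$. A subset of $\widetilde{\mathbb R}^d$ is internal, with representative $(A_\varepsilon)_\varepsilon$ ($A_\varepsilon\subseteq\mathbb R^d$), if it equals $[(A_\varepsilon)_\varepsilon]:=\{\tilde x\in\widetilde{\mathbb R}^d:\tilde x\text{ has a representative }(x_\varepsilon)_\varepsilon\text{ with }x_\varepsilon\in A_\varepsilon\text{ for small }\varepsilon\}$. The representative is sharply bounded if there is $M\in\mathbb N$ with $\sup_{x\in A_\varepsilon}|x|\le\varepsilon^{-M}$ for small $\varepsilon$. For $B\subseteq\mathbb R^d$ and $r>0$, $B+r=\{x\in\mathbb R^d:d(x,B)\le r\}$. $\widetilde{\mathcal G}(A)=\mathcal E_M(A)/\mathcal N(A)$, where $\mathcal E_M(A)$ (resp. $\mathcal N(A)$) is the set of nets $(u_\varepsilon)_\varepsilon$ of $C^\infty$ functions $\mathbb R^d\to\mathbb C$ such that for every $\alpha\in\mathbb N^d$ and every representative $(x_\varepsilon)_\varepsilon$ of every element of $A$, $(\partial^\alpha u_\varepsilon(x_\varepsilon))_\varepsilon\in\mathcal M_{\mathbb C}$ (resp. $\in\mathcal N_{\mathbb C}$). Operations are $\varepsilon$-wise; point values are $u(\tilde x)=[(u_\varepsilon(x_\varepsilon))_\varepsilon]\in\widetilde{\mathbb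 C}$ for $\tilde x=[(x_\varepsilon)_\varepsilon]\in A$ (well-defined). *)

(* Defs.v *)
From HB Require Import structures.
From mathcomp Require Import all_boot all_order all_algebra.
From mathcomp Require Import complex ring.
From mathcomp Require Import all_classical all_reals.
From mathcomp Require Import ereal topology normedtype derive exp.
Import numFieldNormedType.Exports.

Set Implicit Arguments.
Unset Strict Implicit.
Unset Printing Implicit Defensive.
Import Order.TTheory GRing.Theory Num.Theory Normc.
Local Open Scope ring_scope.
Local Open Scope classical_set_scope.
Local Open Scope quotient_scope.

(* Quotient of a commutative ring by an ideal.  The library's {ideal_quot _} is
   restricted to proper ideals of nontrivial rings, which excludes the zero
   ring obtained below for an empty set of generalized points. *)
Section RingQuot.
Variable (T : comPzRingType).

Definition absorbing (S : {pred T}) := forall a, {in S, forall u, a * u \in S}.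

Definition ring_quot (S : zmodClosed T) of absorbing S : Type := {ideal_quot S}.

Variables (S : zmodClosed T) (idS : absorbing S).
Notation Q := (ring_quot idS).

HB.instance Definition _ := GRing.Zmodule.on Q.
HB.instance Definition _ := EqQuotient.on Q.
HB.instance Definition _ := @isZmodQuotient.Build T (Quotient.equiv S)
  0 -%R +%R Q (@pi_zeror _ _ _ _ _ {ideal_quot S}) (@pi_oppr _ _ _ _ _ {ideal_quot S})
  (@pi_addr _ _ _ _ _ {ideal_quot S}).

Definition qone : Q := lift_cst Q 1.
Definition qmul := lift_op2 Q *%R.

Lemma pi_eqP (x y : T) : \pi_Q x = \pi_Q y <-> x - y \in S.
Proof.
split => [|h]; last by apply/eqP; rewrite piE /Quotient.equiv.
by move/eqP; rewrite piE /Quotient.equiv.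
Qed.

Lemma pi_mul (x y : T) : \pi_Q (x * y) = qmul (\pi x) (\pi y).
Proof.
unlock qmul; apply/pi_eqP.
have h z : z - repr (\pi_Q z) \in S by apply/pi_eqP; rewrite reprK.
have aux (a b c d : T) : a * b - c * d = a * (b - d) + d * (a - c).
  by rewrite !mulrBr [d * a]mulrC addrA subrK [d * c]mulrC.
by rewrite aux rpredD// idS.
Qed.

Lemma pi_one : \pi_Q 1 = qone.
Proof. by unlock qone. Qed.

Fact qmulA : associative qmul.
Proof.
by elim/quotW=> x; elim/quotW=> y; elim/quotW=> z; rewrite -!pi_mul mulrA.
Qed.

Fact qmulC : commutative qmul.
Proof. by elim/quotW=> x; elim/quotW=> y; rewrite -!pi_mul mulrC. Qed.

Fact qmul1 : left_id qone qmul.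
Proof. by elim/quotW=> x; rewrite -pi_one -pi_mul mul1r. Qed.

Fact qmulr1 : right_id qone qmul.
Proof. by move=> x; rewrite qmulC qmul1. Qed.

Fact qmulDl : left_distributive qmul +%R.
Proof.
elim/quotW=> x; elim/quotW=> y; elim/quotW=> z.
by rewrite -pi_addr -!pi_mul -pi_addr mulrDl.
Qed.

Fact qmulDr : right_distributive qmul +%R.
Proof. by move=> x y z; rewrite !(qmulC x) qmulDl. Qed.

HB.instance Definition _ :=
  GRing.Zmodule_isPzRing.Build Q qmulA qmul1 qmulr1 qmulDl qmulDr.
HB.instance Definition _ := GRing.PzRing_hasCommutativeMul.Build Q qmulC.

Lemma pi_quotM (x y : T) : \pi_Q (x * y) = \pi_Q x * \pi_Q y.
Proof. exact: pi_mul. Qed.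

End RingQuot.


Section Nets.
Variable R : realType.

Record I01 := MkI01 { epsv : R; epsvP : 0 < epsv < 1 }.

Definition for_small (P : I01 -> Prop) :=
  exists e0 : I01, forall e : I01, epsv e <= epsv e0 -> P e.

Definition moderate (E : Type) (nm : E -> R) (x : I01 -> E) :=
  exists N : nat, for_small (fun e => nm (x e) <= epsv e ^- N).

Definition negligible (E : Type) (nm : E -> R) (x : I01 -> E) :=
  forall m : nat, for_small (fun e => nm (x e) <= epsv e ^+ m).

Lemma I01_gt0 (e : I01) : 0 < epsv e.
Proof. by have /andP[] := epsvP e. Qed.

Lemma I01_lt1 (e : I01) : epsv e < 1.
Proof. by have /andP[] := epsvP e. Qed.

Lemma for_smallI (P Q : I01 -> Prop) :
  for_small P -> for_small Q -> for_small (fun e => P e /\ Q e).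
Proof.
move=> [e1 P1] [e2 Q2]; have [le12|/ltW le21] := leP (epsv e1) (epsv e2).
  by exists e1 => e le1; split; [exact: P1|exact/Q2/(le_trans le1)].
by exists e2 => e le2; split; [exact/P1/(le_trans le2)|exact: Q2].
Qed.

Lemma for_smallS (P Q : I01 -> Prop) :
  (forall e, P e -> Q e) -> for_small P -> for_small Q.
Proof. by move=> PQ [e0 h]; exists e0 => e /h /PQ. Qed.

Lemma for_small_half : for_small (fun e => epsv e <= 2^-1).
Proof.
have h : 0 < (2^-1 : R) < 1 by rewrite invr_gt0 ltr0n invf_lt1 ?ltr1n ?ltr0n.
by exists (MkI01 h).
Qed.

Lemma expI01_le (e : I01) m n : (m <= n)%N -> epsv e ^+ n <= epsv e ^+ m.
Proof.
by move=> mn; rewrite ler_wiXn2l// ltW ?I01_gt0 ?I01_lt1.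
Qed.

Lemma expNI01_le (e : I01) m n : (m <= n)%N -> epsv e ^- m <= epsv e ^- n.
Proof.
by move=> mn; rewrite lef_pV2 ?posrE ?exprn_gt0 ?I01_gt0 ?expI01_le.
Qed.

Section Closure.
Variables (E : zmodType) (nm : E -> R).
Hypothesis nm0 : nm 0 = 0.
Hypothesis nmB : forall x y, nm (x - y) <= 2 * (nm x + nm y).

Let four : 4 = 2 * 2 :> R. Proof. by rewrite -natrM. Qed.

Lemma moderate0 : moderate nm 0.
Proof.
exists 0; exists (sval (cid for_small_half)) => e _ /=.
by rewrite [X in nm X](_ : _ = 0)// nm0 expr0 invr1 ler01.
Qed.

Lemma negligible0 : negligible nm 0.
Proof.
move=> m; exists (sval (cid for_small_half)) => e _ /=.
by rewrite [X in nm X](_ : _ = 0)// nm0 exprn_ge0// ltW ?I01_gt0.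
Qed.

Lemma moderateB (x y : I01 -> E) :
  moderate nm x -> moderate nm y -> moderate nm (x - y).
Proof.
move=> [N hx] [M hy]; exists (maxn N M).+2.
apply: for_smallS (for_smallI for_small_half (for_smallI hx hy)).
move=> e [e2 [xN yM]]; apply: (le_trans (nmB _ _)).
have e0 := I01_gt0 e.
have K := expNI01_le e (leq_maxl N M).
have K' := expNI01_le e (leq_maxr N M).
rewrite !exprS mulrA invfM.
apply: (@le_trans _ _ (4 * epsv e ^- maxn N M)).
  rewrite four -mulrA ler_pM2l// mulr_natl.
  by rewrite mulr2n lerD// ?(le_trans xN K) ?(le_trans yM K').
rewrite ler_pM2r ?invr_gt0 ?exprn_gt0// invfM.
have e2' : 2 <= (epsv e)^-1 by rewrite -[2]invrK lef_pV2// posrE ?invr_gt0.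
by rewrite four ler_pM.
Qed.

Lemma negligibleB (x y : I01 -> E) :
  negligible nm x -> negligible nm y -> negligible nm (x - y).
Proof.
move=> hx hy m.
apply: for_smallS
  (for_smallI for_small_half (for_smallI (hx m.+2) (hy m.+2))).
move=> e [e2 [xN yM]]; apply: (le_trans (nmB _ _)).
have e0 := I01_gt0 e.
apply: (@le_trans _ _ (4 * epsv e ^+ m.+2)).
  rewrite four -mulrA ler_pM2l// mulr_natl.
  by rewrite mulr2n lerD.
rewrite !exprS !mulrA ler_piMl ?exprn_ge0 ?(ltW e0)//.
apply: (@le_trans _ _ (4 * 2^-1 * 2^-1)).
  by rewrite -!mulrA ler_pM2l// ler_pM// ltW.
by rewrite -mulrA -invfM -four divff.
Qed.

End Closure.
End Nets.
Arguments for_small {R}.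

Section GeneralizedNumbers.
Variable R : realType.
Notation I := (I01 R).
Notation C := (R[i]).

Lemma normcB2 (x y : C) : normc (x - y) <= 2 * (normc x + normc y).
Proof.
have nn (z : C) : 0 <= normc z by case: z => a b; rewrite /normc sqrtr_ge0.
rewrite mulr2n mulrDl mul1r; apply: (@le_trans _ _ (normc x + normc y)).
  by rewrite -(normcN y) le_normcD.
by rewrite lerDl addr_ge0.
Qed.

Definition moderateC : {pred I -> C} := fun x => `[< moderate (@normc R) x >].

Fact moderateC_subring : subring_closed moderateC.
Proof.
split.
- apply/asboolP; exists 0; exists (sval (cid (for_small_half R))) => e _.
  by rewrite (normc1 R) expr0 invr1.
- move=> x y /asboolP hx /asboolP hy; apply/asboolP.
  exact: (moderateB normcB2).
move=> x y /asboolP[N hx] /asboolP[M hy]; apply/asboolP; exists (N + M)%N.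
apply: for_smallS (for_smallI hx hy) => e [he he'].
rewrite [X in normc X](_ : _ = x e * y e)// normcM exprD invfM ler_pM//.
- by case: (x e) => a b; rewrite /normc sqrtr_ge0.
- by case: (y e) => a b; rewrite /normc sqrtr_ge0.
Qed.
HB.instance Definition _ :=
  GRing.isSubringClosed.Build (I -> C) moderateC moderateC_subring.

Record M_C := MkM_C { MC_net :> I -> C; _ : MC_net \in moderateC }.
HB.instance Definition _ := [isSub for MC_net].
HB.instance Definition _ := [Choice of M_C by <:].
HB.instance Definition _ := 
  GRing.SubChoice_isSubComPzRing.Build (I -> C) moderateC M_C moderateC_subring.

Definition N_C : {pred M_C} := fun x => `[< negligible (@normc R) x >].

Fact NC_zmod : zmod_closed N_C.
Proof.
split; first by apply/asboolP; exact: (negligible0 (normc0 R)).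
move=> x y /asboolP hx /asboolP hy; apply/asboolP.
exact: (negligibleB normcB2).
Qed.
HB.instance Definition _ := GRing.isZmodClosed.Build M_C N_C NC_zmod.

Fact NC_absorbing : absorbing N_C.
Proof.
move=> x y /asboolP hy; have /asboolP[N hx] := valP x.
apply/asboolP => m.
apply: for_smallS (for_smallI hx (hy (m + N)%N)) => e [he he'].
rewrite [X in normc X](_ : _ = x e * y e)// normcM.
have e0 : epsv e != 0 by rewrite gt_eqF ?I01_gt0.
rewrite -[leRHS]mul1r -(@mulVf _ (epsv e ^+ N)) ?expf_neq0//.
rewrite -mulrA [_ ^+ N * _]mulrC -exprD ler_pM//.
- by case: (x e) => a b; rewrite /normc sqrtr_ge0.
- by case: (y e) => a b; rewrite /normc sqrtr_ge0.
Qed.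

Definition Ctilde := ring_quot NC_absorbing.
HB.instance Definition _ := GRing.ComPzRing.on Ctilde.
HB.instance Definition _ := EqQuotient.on Ctilde.

Section GeneralizedPoints.
Variable d : nat.
Notation V := ('rV[R]_d).

(* Euclidean norm; the norm `|x| of the library on row vectors is the sup norm *)
Definition enorm (x : V) : R := Num.sqrt (\sum_i x 0 i ^+ 2).

Lemma enorm_ge0 x : 0 <= enorm x. Proof. exact: sqrtr_ge0. Qed.

Lemma enorm0 : enorm 0 = 0.
Proof.
by rewrite /enorm big1 ?sqrtr0// => i _; rewrite mxE expr0n.
Qed.

Lemma sqr_enorm x : enorm x ^+ 2 = \sum_i x 0 i ^+ 2.
Proof. by rewrite sqr_sqrtr// sumr_ge0// => i _; rewrite sqr_ge0. Qed.

Lemma enormB2 x y : enorm (x - y) <= 2 * (enorm x + enorm y).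
Proof.
have h0 : 0 <= enorm x + enorm y by rewrite addr_ge0 ?enorm_ge0.
rewrite -(@ler_pXn2r _ 2) ?nnegrE ?enorm_ge0 ?mulr_ge0//.
apply: (@le_trans _ _ (2 * (enorm x ^+ 2 + enorm y ^+ 2))).
  rewrite !sqr_enorm -big_split/= mulr_sumr ler_sum// => i _.
  rewrite !mxE -subr_ge0.
  by rewrite [leRHS](_ : _ = (x 0 i + y 0 i) ^+ 2) ?sqr_ge0//; ring.
rewrite exprMn (_ : 2 ^+ 2 = 2 * 2)// -mulrA ler_pM2l//.
rewrite (@le_trans _ _ ((enorm x + enorm y) ^+ 2))//.
  by rewrite sqrrD -addrA lerD2l lerDr mulrn_wge0// mulr_ge0 ?enorm_ge0.
by rewrite mulr_natl mulr2n lerDl sqr_ge0.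
Qed.

Definition moderateR : {pred I -> V} := fun x => `[< moderate enorm x >].

Fact moderateR_zmod : zmod_closed moderateR.
Proof.
split; first by apply/asboolP; exact: (moderate0 enorm0).
move=> x y /asboolP hx /asboolP hy; apply/asboolP.
exact: (moderateB enormB2).
Qed.
HB.instance Definition _ :=
  GRing.isZmodClosed.Build (I -> V) moderateR moderateR_zmod.

Record M_R := MkM_R { MR_net :> I -> V; _ : MR_net \in moderateR }.
HB.instance Definition _ := [isSub for MR_net].
HB.instance Definition _ := [Choice of M_R by <:].
HB.instance Definition _ := [SubChoice_isSubZmodule of M_R by <:].

Definition N_R : {pred M_R} := fun x => `[< negligible enorm x >].

Fact NR_zmod : zmod_closed N_R.
Proof.
split; first by apply/asboolP; exact: (negligible0 enorm0).
move=> x y /asboolP hx /asboolP hy; apply/asboolP.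
exact: (negligibleB enormB2).
Qed.
HB.instance Definition _ := GRing.isZmodClosed.Build M_R N_R NR_zmod.

Definition Rtilde := {ideal_quot N_R}.
HB.instance Definition _ := GRing.Zmodule.on Rtilde.
HB.instance Definition _ := EqQuotient.on Rtilde.

End GeneralizedPoints.
End GeneralizedNumbers.
Arguments moderateC : clear implicits.
Arguments N_C : clear implicits.

Section Smooth.
Variables (R : realType) (d : nat).
Notation C := (R[i]).
Notation V := ('rV[R]_d).
Implicit Types (f g : V -> C) (i : 'I_d).

(* i-th partial derivative of a complex-valued function, taken on the real and
   imaginary parts *)
Definition partial i f : V -> C := fun x =>
  Complex ('D_(delta_mx 0 i) (fun y => complex.Re (f y)) x)
          ('D_(delta_mx 0 i) (fun y => complex.Im (f y)) x).

(* Continuous, with first-order partial derivatives everywhere. *)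
Definition partially_derivable f :=
  [/\ continuous (fun x => complex.Re (f x)),
      continuous (fun x => complex.Im (f x)) &
      forall i x, derivable (fun y => complex.Re (f y)) x (delta_mx 0 i) /\
                  derivable (fun y => complex.Im (f y)) x (delta_mx 0 i)].

(* C^oo: all iterated partial derivatives, in any order, exist everywhere and
   are continuous *)
Definition smooth f :=
  forall s : seq 'I_d, partially_derivable (foldr partial f s).

Definition partials (s : seq 'I_d) (alpha : 'I_d -> nat) f : V -> C :=
  foldr (fun i => iter (alpha i) (partial i)) f s.

(* d_0^(alpha 0) ... d_(d-1)^(alpha (d-1)) f *)
Definition multi_partial (alpha : 'I_d -> nat) f := partials (enum 'I_d) alpha f.

Lemma partially_derivable_cst (c : C) : partially_derivable (cst c).
Proof.
split=> [||i x]; [exact: cst_continuous|exact: cst_continuous|].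
by split; exact: derivable_cst.
Qed.

Lemma partial_cst i (c : C) : partial i (cst c) = cst 0.
Proof. by apply/funext => x; congr Complex; exact: derive_cst. Qed.

Lemma ReB f g : (fun x => complex.Re ((f - g) x)) =
  (fun x => complex.Re (f x)) - (fun x => complex.Re (g x)).
Proof. by apply/funext => x; rewrite !fctE; case: (f x); case: (g x). Qed.

Lemma ImB f g : (fun x => complex.Im ((f - g) x)) =
  (fun x => complex.Im (f x)) - (fun x => complex.Im (g x)).
Proof. by apply/funext => x; rewrite !fctE; case: (f x); case: (g x). Qed.

Lemma ReM f g : (fun x => complex.Re ((f * g) x)) =
  (fun x => complex.Re (f x)) * (fun x => complex.Re (g x)) -
  (fun x => complex.Im (f x)) * (fun x => complex.Im (g x)).
Proof. by apply/funext => x; rewrite !fctE; case: (f x); case: (g x). Qed.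

Lemma ImM f g : (fun x => complex.Im ((f * g) x)) =
  (fun x => complex.Re (f x)) * (fun x => complex.Im (g x)) +
  (fun x => complex.Im (f x)) * (fun x => complex.Re (g x)).
Proof. by apply/funext => x; rewrite !fctE; case: (f x); case: (g x). Qed.

Lemma partially_derivableB f g : partially_derivable f ->
  partially_derivable g -> partially_derivable (f - g).
Proof.
move=> [fr fi fd] [gr gi gd]; split.
- by rewrite ReB => x; exact: (cvgB (fr x) (gr x)).
- by rewrite ImB => x; exact: (cvgB (fi x) (gi x)).
move=> i x; have [fR fI] := fd i x; have [gR gI] := gd i x.
by rewrite ReB ImB; split; [exact: (derivableB fR gR)|exact: (derivableB fI gI)].
Qed.

Lemma partially_derivableM f g : partially_derivable f ->
  partially_derivable g -> partially_derivable (f * g).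
Proof.
move=> [fr fi fd] [gr gi gd]; split.
- by rewrite ReM => x; exact: (cvgB (cvgM (fr x) (gr x)) (cvgM (fi x) (gi x))).
- by rewrite ImM => x; exact: (cvgD (cvgM (fr x) (gi x)) (cvgM (fi x) (gr x))).
move=> i x; have [fR fI] := fd i x; have [gR gI] := gd i x.
rewrite ReM ImM; split.
  exact: (derivableB (derivableM fR gR) (derivableM fI gI)).
exact: (derivableD (derivableM fR gI) (derivableM fI gR)).
Qed.

Lemma partialB i f g : partially_derivable f -> partially_derivable g ->
  partial i (f - g) = partial i f - partial i g.
Proof.
move=> [_ _ fd] [_ _ gd]; apply/funext => x; rewrite /partial.
have [fR fI] := fd i x; have [gR gI] := gd i x.
by rewrite ReB ImB (deriveB fR gR) (deriveB fI gI).
Qed.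

Lemma partialM i f g : partially_derivable f -> partially_derivable g ->
  partial i (f * g) = partial i f * g - (- f) * partial i g.
Proof.
move=> [_ _ fd] [_ _ gd]; apply/funext => x; rewrite /partial.
have [fR fI] := fd i x; have [gR gI] := gd i x.
rewrite ReM ImM (deriveB (derivableM fR gR) (derivableM fI gI)).
rewrite (deriveD (derivableM fR gI) (derivableM fI gR)).
rewrite (deriveM fR gR) (deriveM fI gI) (deriveM fR gI) (deriveM fI gR).
rewrite !fctE.
move: (derive _ _ _) (derive _ _ _) (derive _ _ _) (derive _ _ _).
case: (f x) => a b; case: (g x) => a' b' /= p q r s.
by rewrite /GRing.scale/=; congr Complex; ring.
Qed.

(* partially_derivable iterated partial derivatives up to order n *)
Fixpoint smoothn n f := if n is m.+1 then
  partially_derivable f /\ forall i, smoothn m (partial i f)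
  else partially_derivable f.

Lemma smoothnP f : smooth f <-> forall n, smoothn n f.
Proof.
split=> [+ n|]; first elim: n f => [|n IH] f sf /=; first exact: (sf [::]).
  split; first exact: (sf [::]).
  by move=> i; apply: IH => s; have := sf (rcons s i); rewrite foldr_rcons.
move=> sf s; elim/last_ind: s f sf => [|s i IH] f sf; first exact: (sf 0).
by rewrite foldr_rcons; apply: IH => n; have [_] := sf n.+1; apply.
Qed.

Lemma smoothnW n f : smoothn n.+1 f -> smoothn n f.
Proof.
elim: n f => [|n IH] f; first by case.
by move=> [df h]; split=> // i; apply: IH; exact: h.
Qed.

Lemma smoothn_pd n f : smoothn n f -> partially_derivable f.
Proof. by case: n => // n []. Qed.

Lemma smoothn_cst n c : smoothn n (cst c).
Proof.
elim: n c => [|n IH] c; first exact: partially_derivable_cst.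
by split=> [|i]; [exact: partially_derivable_cst|rewrite partial_cst].
Qed.

Lemma smoothnB n f g : smoothn n f -> smoothn n g -> smoothn n (f - g).
Proof.
elim: n f g => [|n IH] f g; first exact: partially_derivableB.
move=> [df hf] [dg hg]; split=> [|i]; first exact: partially_derivableB.
by rewrite partialB//; apply: IH; [exact: hf|exact: hg].
Qed.

Lemma smoothnN n f : smoothn n f -> smoothn n (- f).
Proof. by move=> h; rewrite -sub0r; apply: smoothnB => //; exact: smoothn_cst. Qed.

Lemma smoothnM n f g : smoothn n f -> smoothn n g -> smoothn n (f * g).
Proof.
elim: n f g => [|n IH] f g; first exact: partially_derivableM.
move=> sf sg; have [df hf] := sf; have [dg hg] := sg.
split=> [|i]; first exact: partially_derivableM.
rewrite partialM//; apply: smoothnB; apply: IH.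
- exact: hf.
- exact: smoothnW.
- exact/smoothnN/smoothnW.
- exact: hg.
Qed.

Lemma smooth_cst c : smooth (cst c).
Proof. by apply/smoothnP => n; exact: smoothn_cst. Qed.

Lemma smoothB f g : smooth f -> smooth g -> smooth (f - g).
Proof.
by move=> /smoothnP sf /smoothnP sg; apply/smoothnP => n; exact: smoothnB.
Qed.

Lemma smoothN f : smooth f -> smooth (- f).
Proof. by move=> /smoothnP sf; apply/smoothnP => n; exact: smoothnN. Qed.

Lemma smoothM f g : smooth f -> smooth g -> smooth (f * g).
Proof.
by move=> /smoothnP sf /smoothnP sg; apply/smoothnP => n; exact: smoothnM.
Qed.

Lemma smooth_pd f : smooth f -> partially_derivable f.
Proof. by move/(_ [::]). Qed.

Lemma smooth_partial i f : smooth f -> smooth (partial i f).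
Proof. by move=> sf s; have := sf (rcons s i); rewrite foldr_rcons. Qed.

Lemma smooth_iter i n f : smooth f -> smooth (iter n (partial i) f).
Proof. by move=> sf; elim: n => [|n IH]; [exact: sf|exact: smooth_partial]. Qed.

Lemma iter_partialB i n f g : smooth f -> smooth g ->
  iter n (partial i) (f - g) = iter n (partial i) f - iter n (partial i) g.
Proof.
move=> sf sg; elim: n => [|n IH] //=.
by rewrite IH partialB; [|exact/smooth_pd/smooth_iter..].
Qed.

Lemma smooth_partials s a f : smooth f -> smooth (partials s a f).
Proof. by move=> sf; elim: s => [|i s IH]; [exact: sf|exact: smooth_iter]. Qed.

Lemma partialsB s a f g : smooth f -> smooth g ->
  partials s a (f - g) = partials s a f - partials s a g.
Proof.
move=> sf sg; elim: s => [|i s IH] //=.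
by rewrite IH iter_partialB; [|exact: smooth_partials..].
Qed.

Lemma partials_cst s a c : exists c', partials s a (cst c) = cst c' /\
  (c' = c \/ c' = 0).
Proof.
elim: s => [|i s [c' [IH h]]] /=; first by exists c; split; [|left].
rewrite IH; elim: (a i) => [|n [c2 [/= -> h2]]]; first by exists c'.
by exists 0; rewrite partial_cst; split; [|right].
Qed.

Lemma partials_rcons s i a f :
  partials (rcons s i) a f = partials s a (iter (a i) (partial i) f).
Proof. by rewrite /partials foldr_rcons. Qed.

Lemma eq_partials s a b f : {in s, a =1 b} -> partials s a f = partials s b f.
Proof.
elim: s => //= i s IH ab; rewrite ab ?inE ?eqxx// IH// => j js.
by rewrite ab// inE js orbT.
Qed.

Lemma multi_partial0 f : multi_partial (fun=> 0%N) f = f.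
Proof. by rewrite /multi_partial; elim: (enum _). Qed.

End Smooth.

Section Leibniz.
Variables (R : realType) (d : nat).
Notation I := (I01 R).
Notation C := (R[i]).
Notation V := ('rV[R]_d).
Implicit Types u v : I -> V -> C.
Variables (P Q S : (I -> C) -> Prop).
Hypothesis SB : forall a b, S a -> S b -> S (a - b).
Hypothesis PQS : forall a b, P a -> Q b -> S (a * b).
Hypothesis PN : forall a, P a -> P (- a).
Variable x : I -> V.

Let along (K : (I -> C) -> Prop) s u :=
  forall a : 'I_d -> nat, K (fun e => partials s a (u e) (x e)).

Let along_iter K s i u : i \notin s -> along K (rcons s i) u ->
  forall k, along K s (fun e => iter k (partial i) (u e)).
Proof.
move=> si h k a; have := h (fun j => if j == i then k else a j).
congr K; apply/funext => e; rewrite partials_rcons eqxx.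
rewrite (@eq_partials _ _ s _ a)// => j js.
by case: eqP si js => // -> /negbTE ->.
Qed.

Let alongM_iter s i : i \notin s ->
  (forall u v, (forall e, smooth (u e)) -> (forall e, smooth (v e)) ->
     along P s u -> along Q s v -> along S s (fun e => u e * v e)) ->
  forall k u v, (forall e, smooth (u e)) -> (forall e, smooth (v e)) ->
    (forall k, along P s (fun e => iter k (partial i) (u e))) ->
    (forall k, along Q s (fun e => iter k (partial i) (v e))) ->
    along S s (fun e => iter k (partial i) (u e * v e)).
Proof.
move=> si IH; elim=> [|k IHk] u v su sv hu hv.
  by apply: IH => //; [exact: (hu 0)|exact: (hv 0)].
have spu e : smooth (partial i (u e)) by exact: smooth_partial.
have spv e : smooth (partial i (v e)) by exact: smooth_partial.
have sNu e : smooth (- u e) by exact: smoothN.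
have iN j e : iter j (partial i) (- u e) = - iter j (partial i) (u e).
  rewrite -[- u e]sub0r iter_partialB//; last exact: smooth_cst.
  have -> : iter j (partial i) (cst 0 : V -> C) = cst 0.
    by elim: j => //= j ->; exact: partial_cst.
  exact: sub0r.
have A1 : along S s (fun e => iter k (partial i) (partial i (u e) * v e)).
  by apply: IHk => // j; have := hu j.+1; under eq_fun do rewrite iterSr.
have A2 : along S s (fun e => iter k (partial i) ((- u e) * partial i (v e))).
  apply: IHk => // j; last by have := hv j.+1; under eq_fun do rewrite iterSr.
  move=> a; have := PN (hu j a); congr P; apply/funext => e.
  rewrite iN -[X in partials _ _ X]sub0r partialsB; last exact: smooth_iter.
    have [c [-> hc]] := partials_cst s a (0 : C).
    by rewrite !fctE; case: hc => ->; rewrite sub0r.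
  exact: smooth_cst.
move=> a; have := SB (A1 a) (A2 a); congr S; apply/funext => e.
rewrite iterSr partialM; [|exact: smooth_pd..].
rewrite iter_partialB; [|exact: smoothM..].
by rewrite partialsB//; apply: smooth_iter; exact: smoothM.
Qed.

Lemma leibniz s u v : uniq s -> (forall e, smooth (u e)) ->
  (forall e, smooth (v e)) ->
  (forall a, P (fun e => partials s a (u e) (x e))) ->
  (forall a, Q (fun e => partials s a (v e) (x e))) ->
  forall a, S (fun e => partials s a (u e * v e) (x e)).
Proof.
elim/last_ind: s u v => [|s i IH] u v.
  by move=> _ _ _ hu hv a; exact: PQS (hu a) (hv a).
rewrite rcons_uniq => /andP[si us] su sv hu hv a.
have IH' u' v' su' sv' hu' hv' := IH u' v' us su' sv' hu' hv'.
have := alongM_iter si IH' (a i) su sv (along_iter si hu) (along_iter si hv) a.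
by congr S; apply/funext => e; rewrite partials_rcons.
Qed.

End Leibniz.

Section GeneralizedFunctions.
Variables (R : realType) (d : nat).
Notation I := (I01 R).
Notation C := (R[i]).
Notation V := ('rV[R]_d).
Variable A : set (Rtilde R d).

(* A net x of points of R^d represents an element of A when A (\pi x) *)
Definition moderateG : {pred I -> V -> C} := fun u => `[<
  (forall e, smooth (u e)) /\
  forall (alpha : 'I_d -> nat) (x : M_R R d), A (\pi_(Rtilde R d) x) ->
    moderate (@normc R) (fun e => multi_partial alpha (u e) (x e)) >].

Lemma moderateN (a : I -> C) :
  moderate (@normc R) a -> moderate (@normc R) (- a).
Proof.
move=> ha; have ma : a \in moderateC R by exact/asboolP.
have : - a \in moderateC R by rewrite rpredN.
by move/asboolP.
Qed.

Fact moderateG_subring : subring_closed moderateG.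
Proof.
split.
- apply/asboolP; split=> [e|a x Ax]; first exact: (smooth_cst 1).
  have [c [hc h]] := partials_cst (enum 'I_d) a (1 : C).
  suff -> : (fun e : I => multi_partial a ((1 : I -> V -> C) e) (x e)) = cst c.
    have m1 : (1 : I -> C) \in moderateC R by exact: rpred1.
    have m0 : (0 : I -> C) \in moderateC R by exact: rpred0.
    by case: h => ->; [move: m1 => /asboolP|move: m0 => /asboolP].
  by apply/funext => e; rewrite -[RHS]/(cst c (x e)) -hc.
- move=> u v /asboolP[su hu] /asboolP[sv hv]; apply/asboolP.
  split=> [e|a x Ax]; first exact: smoothB.
  have := moderateB (@normcB2 R) (hu a x Ax) (hv a x Ax).
  by congr moderate; apply/funext => e; rewrite /multi_partial partialsB.
move=> u v /asboolP[su hu] /asboolP[sv hv]; apply/asboolP.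
split=> [e|a x Ax]; first exact: smoothM.
apply: (@leibniz _ _ (moderate (@normc R)) (moderate (@normc R))) => //.
- exact: (moderateB (@normcB2 R)).
- move=> b c hb hc.
  have mb : b \in moderateC R by exact/asboolP.
  have mc : c \in moderateC R by exact/asboolP.
  have : b * c \in moderateC R by exact: rpredM.
  by move/asboolP.
- exact: moderateN.
- exact: enum_uniq.
- by move=> b; exact: hu.
- by move=> b; exact: hv.
Qed.
HB.instance Definition _ :=
  GRing.isSubringClosed.Build (I -> V -> C) moderateG moderateG_subring.

Record E_M := MkE_M { EM_net :> I -> V -> C; _ : EM_net \in moderateG }.
HB.instance Definition _ := [isSub for EM_net].
HB.instance Definition _ := [Choice of E_M by <:].
HB.instance Definition _ :=
  GRing.SubChoice_isSubComPzRing.Build (I -> V -> C) moderateG E_M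
    moderateG_subring.

Definition N_G : {pred E_M} := fun u => `[<
  forall (alpha : 'I_d -> nat) (x : M_R R d), A (\pi_(Rtilde R d) x) ->
    negligible (@normc R) (fun e => multi_partial alpha (u e) (x e)) >].

Lemma EM_smooth (u : E_M) e : smooth (u e).
Proof. by have /asboolP[] := valP u. Qed.

Lemma EM_moderate (u : E_M) alpha (x : M_R R d) : A (\pi_(Rtilde R d) x) ->
  moderate (@normc R) (fun e => multi_partial alpha (u e) (x e)).
Proof. by have /asboolP[_] := valP u; apply. Qed.

Fact NG_zmod : zmod_closed N_G.
Proof.
split=> [|u v /asboolP hu /asboolP hv]; apply/asboolP => a x Ax.
  have [c [hc h]] := partials_cst (enum 'I_d) a (0 : C).
  suff -> : (fun e : I => multi_partial a ((0 : E_M) e) (x e)) = 0.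
    exact: (negligible0 (normc0 R)).
  apply/funext => e; rewrite -[LHS]/(partials _ _ (cst 0) _) hc.
  by case: h => ->.
have := negligibleB (@normcB2 R) (hu a x Ax) (hv a x Ax).
congr negligible; apply/funext => e.
by rewrite -[RHS]/(partials _ _ (u e - v e) _) partialsB//; exact: EM_smooth.
Qed.
HB.instance Definition _ := GRing.isZmodClosed.Build E_M N_G NG_zmod.

Lemma moderate_negligibleM (a b : I -> C) : moderate (@normc R) a ->
  negligible (@normc R) b -> negligible (@normc R) (a * b).
Proof.
move=> ha hb; have ma : a \in moderateC R by exact/asboolP.
have mb : b \in moderateC R.
  apply/asboolP; exists 0; apply: for_smallS (hb 0) => e.
  by rewrite expr0 invr1.
have nb : MkM_C mb \in N_C R by exact/asboolP.
by have /asboolP := NC_absorbing (MkM_C ma) nb.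
Qed.

Fact NG_absorbing : absorbing N_G.
Proof.
move=> u v /asboolP hv; apply/asboolP => a x Ax.
apply: (@leibniz _ _ (moderate (@normc R)) (negligible (@normc R))
  (negligible (@normc R)) _ _ _ x (enum 'I_d) u v) => //.
- exact: (negligibleB (@normcB2 R)).
- exact: moderate_negligibleM.
- exact: moderateN.
- exact: enum_uniq.
- exact: EM_smooth.
- exact: EM_smooth.
- by move=> b; exact: EM_moderate.
- by move=> b; exact: hv.
Qed.

Definition Gtilde := ring_quot NG_absorbing.
HB.instance Definition _ := GRing.ComPzRing.on Gtilde.
HB.instance Definition _ := EqQuotient.on Gtilde.

End GeneralizedFunctions.

Section Points.
Variables (R : realType) (d : nat).
Notation I := (I01 R).
Notation V := ('rV[R]_d).

Definition valuation_net (x : I -> V) : \bar R :=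
  ereal_sup [set b%:E | b in
    [set b : R | for_small (fun e => enorm (x e) <= epsv e `^ b)]].

(* independent of the representative by valuationE *)
Definition valuation (xt : Rtilde R d) : \bar R := valuation_net (repr xt).

Definition sharp_norm (xt : Rtilde R d) : \bar R := expeR (- valuation xt)%E.

Definition sharply_bounded (A : set (Rtilde R d)) : Prop :=
  (ereal_sup [set sharp_norm xt | xt in A] < +oo)%E.

Definition internal_set (Ae : I -> set V) : set (Rtilde R d) :=
  [set xt | exists x : M_R R d, xt = \pi_(Rtilde R d) x /\
     for_small (fun e => Ae e (x e))].

Definition internal (A : set (Rtilde R d)) : Prop :=
  exists Ae : I -> set V, A = internal_set Ae.

Definition sharply_bounded_rep (Ae : I -> set V) : Prop :=
  exists M : nat, for_small (fun e =>
    (ereal_sup [set (enorm x)%:E | x in Ae e] <= (epsv e ^- M)%:E)%E).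

(* +oo when B is empty *)
Definition edist_set (x : V) (B : set V) : \bar R :=
  ereal_inf [set (enorm (x - y))%:E | y in B].

Definition enlarge (B : set V) (r : R) : set V :=
  [set x | (edist_set x B <= r%:E)%E].

Lemma pi_RtildeP (x y : M_R R d) :
  \pi_(Rtilde R d) x = \pi_(Rtilde R d) y <-> negligible (@enorm R d) (x - y).
Proof.
have -> : (\pi_(Rtilde R d) x = \pi_(Rtilde R d) y) <-> (x - y \in @N_R R d).
  split => [|h]; last by apply/eqP; rewrite piE /Quotient.equiv.
  by move/eqP; rewrite piE /Quotient.equiv.
by split=> [/asboolP|h]; last exact/asboolP.
Qed.

Lemma for_small_powR (c : R) : 0 < c ->
  for_small (fun e : I => epsv e `^ c <= 4^-1).
Proof.
move=> c0; pose t : R := 4^-1 `^ c^-1.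
have t0 : 0 < t by rewrite powR_gt0// invr_gt0.
have tc : t `^ c = 4^-1.
  by rewrite -powRrM mulVf ?gt_eqF// powRr1// invr_ge0.
have h : 0 < Num.min t 2^-1 < 1.
  by rewrite lt_min t0 invr_gt0 ltr0n gt_min invf_lt1 ?ltr1n ?ltr0n ?orbT.
exists (MkI01 h) => e /= et.
rewrite -tc ge0_ler_powR ?nnegrE ?(ltW c0) ?(ltW t0) ?(ltW (I01_gt0 e))//.
by rewrite (le_trans et)// ge_min lexx.
Qed.

Lemma valuation_net_le (x y : I -> V) :
  negligible (@enorm R d) (x - y) -> (valuation_net x <= valuation_net y)%E.
Proof.
move=> xy; apply: ge_ereal_sup => _ [b hb <-].
apply/lee_addgt0Pr => c c0; rewrite -leeBlDr//.
apply: ereal_sup_ubound; exists (b - c) => //=.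
have [m bm] : exists m : nat, b <= m%:R.
  by exists (Num.truncn `|b|).+1; rewrite (le_trans (ler_norm b))// ltW// truncnS_gt.
apply: for_smallS (for_smallI (for_small_powR c0) (for_smallI hb (xy m))).
move=> e [ec [xb xym]].
have e0 := I01_gt0 e; have e1 := ltW (I01_lt1 e).
have -> : y e = x e - (x - y) e by rewrite !fctE opprB addrC subrK.
apply: (le_trans (enormB2 _ _)).
have mb : epsv e ^+ m <= epsv e `^ b.
  rewrite -powR_mulrn ?(ltW e0)//.
  by rewrite ger_powR// e0.
apply: (@le_trans _ _ (4 * epsv e `^ b)).
  rewrite (_ : 4 = 2 * 2); last by rewrite -natrM.
  by rewrite -mulrA ler_pM2l// mulr_natl mulr2n lerD// (le_trans xym).
rewrite powRB ?(gt_eqF e0) ?implybT// ler_pdivlMr ?powR_gt0//.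
rewrite mulrAC -[leRHS]mul1r ler_wpM2r ?powR_ge0//.
by rewrite -ler_pdivlMl// mulr1.
Qed.

Lemma valuationE (x : M_R R d) : valuation (\pi_(Rtilde R d) x) = valuation_net x.
Proof.
have h : \pi_(Rtilde R d) (repr (\pi_(Rtilde R d) x)) = \pi_(Rtilde R d) x.
  by rewrite reprK.
apply/eqP; rewrite eq_le; apply/andP; split; apply: valuation_net_le.
  exact/pi_RtildeP.
exact/pi_RtildeP/esym.
Qed.

End Points.

Section PointValues.
Variables (R : realType) (d : nat).
Notation I := (I01 R).
Notation C := (R[i]).
Notation V := ('rV[R]_d).
Notation e_ k := (delta_mx 0 k : V).

Lemma is_derive_line (f : V -> R) (w v : V) (t : R) :
  derivable f (w + t *: v) v ->
  is_derive t 1 (fun s => f (w + s *: v)) ('D_v f (w + t *: v)).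
Proof.
move=> df; pose F (h : R) := h^-1 *: (f (h *: v + (w + t *: v)) - f (w + t *: v)).
have FE : (fun h : R => h^-1 *: (((fun s => f (w + s *: v)) \o shift t) (h *: 1)
   - f (w + t *: v))) = F.
  apply/funext => h; rewrite /F /=; do 3! f_equal.
  by rewrite [h *: 1]mulr1 scalerDl addrCA.
apply: DeriveDef; last by rewrite /derive FE.
by rewrite /derivable FE; exact: df.
Qed.

Lemma MVT_line (f : V -> R) (v w : V) (h : R) :
  (forall x, derivable f x v) ->
  exists2 c : R, `|c| <= `|h| &
    f (w + h *: v) - f w = 'D_v f (w + c *: v) * h.
Proof.
move=> df; pose p (s : R) := f (w + s *: v).
have dp (t : R) : is_derive t 1 p ('D_v f (w + t *: v)) by exact: is_derive_line.
have cp a b : {within `[a, b], continuous p}.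
  apply: continuous_subspaceT => t.
  apply: differentiable_continuous; apply/derivable1_diffP.
  exact: (@ex_derive _ _ _ _ _ _ _ (dp t)).
have p0 : f w = p 0 by rewrite /p scale0r addr0.
rewrite p0 -/(p h); have [h0|h0] := leP 0 h.
  have [c] := MVT_segment h0 (fun t _ => dp t) (cp _ _).
  rewrite in_itv/= => /andP[c0 ch] ->; exists c; last by rewrite subr0.
  by rewrite !ger0_norm.
have [c] := MVT_segment (ltW h0) (fun t _ => dp t) (cp _ _).
rewrite in_itv/= => /andP[hc c0] E; exists c.
  by rewrite !ler0_norm ?lerN2// ltW.
by rewrite -opprB E sub0r mulrN opprK.
Qed.

Lemma coord_le_enorm (x : V) k : `|x 0 k| <= enorm x.
Proof.
rewrite -sqrtr_sqr ler_wsqrtr// (bigD1 k)//= lerDl sumr_ge0// => i _.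
exact: sqr_ge0.
Qed.

Lemma enorm_mono (x y : V) : (forall k, `|x 0 k| <= `|y 0 k|) ->
  enorm x <= enorm y.
Proof.
move=> xy; rewrite ler_wsqrtr// ler_sum// => k _.
rewrite -(@real_normK _ (x 0 k)) ?num_real// -(@real_normK _ (y 0 k)) ?num_real//.
by rewrite lerXn2r ?nnegrE.
Qed.

Lemma normc_Re_Im (z : C) : normc z <= `|complex.Re z| + `|complex.Im z|.
Proof.
case: z => a b /=; rewrite -(@ler_pXn2r _ 2) ?nnegrE ?sqrtr_ge0 ?addr_ge0//.
rewrite sqr_sqrtr ?addr_ge0 ?sqr_ge0// sqrrD !real_normK ?num_real//.
by rewrite lerD2r lerDl mulrn_wge0// mulr_ge0.
Qed.

Lemma Re_le_normc (z : C) : `|complex.Re z| <= normc z.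
Proof. by case: z => a b /=; rewrite -sqrtr_sqr ler_wsqrtr// lerDl sqr_ge0. Qed.

Lemma Im_le_normc (z : C) : `|complex.Im z| <= normc z.
Proof. by case: z => a b /=; rewrite -sqrtr_sqr ler_wsqrtr// lerDr sqr_ge0. Qed.

Variable A : set (Rtilde R d).

Lemma EM_moderate_partial (u : E_M A) k (x : M_R R d) : A (\pi_(Rtilde R d) x) ->
  moderate (@normc R) (fun e => partial k (u e) (x e)).
Proof.
move=> Ax; have := EM_moderate u (fun j => (j == k)%N : nat) Ax.
congr moderate; apply/funext => e; congr (_ _).
rewrite /multi_partial; have : k \in enum 'I_d by rewrite mem_enum.
have := enum_uniq 'I_d; elim: (enum _) => //= j s IH /andP[js us].
have z s' : k \notin s' ->
    partials s' (fun j => (j == k)%N : nat) (u e) = u e.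
  elim: s' => //= i s' IH'; rewrite inE negb_or eq_sym => /andP[/negbTE -> /=].
  exact: IH'.
rewrite inE; case: eqP => [kj _|/eqP kj /= ks]; last first.
  by rewrite eq_sym (negbTE kj)/= IH.
by subst j; rewrite -/(partials s _ _) eqxx /= z.
Qed.

Let hybrid (x y : V) (k : nat) : V :=
  \row_j (if (j < k)%N then y 0 j else x 0 j).

Let step (x y : M_R R d) (k : 'I_d) (u : E_M A) (p : C -> R) :
  (forall z, `|p z| <= normc z) ->
  (forall e z, derivable (fun v => p (u e v)) z (e_ k)) ->
  (forall e z, 'D_(e_ k) (fun v => p (u e v)) z = p (partial k (u e) z)) ->
  A (\pi_(Rtilde R d) x) -> negligible (@enorm R d) (x - y) ->
  negligible (@Num.norm R R) (fun e =>
    p (u e (hybrid (x e) (y e) k.+1)) - p (u e (hybrid (x e) (y e) k))).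
Proof.
move=> pn pd pE Ax xy.
pose h e := y e 0 k - x e 0 k.
pose w e := hybrid (x e) (y e) k.
have wS e : hybrid (x e) (y e) k.+1 = w e + h e *: e_ k.
  apply/rowP => j; rewrite !mxE eqxx/= ltnS leq_eqVlt -val_eqE/=.
  case: (ltngtP j k) => [jk|jk|jk] /=; rewrite ?mulr0 ?addr0//.
  by rewrite mulr1 (ord_inj jk) addrC subrK.
have mvt e := MVT_line (w e) (h e) (pd e).
pose c e := s2val (cid2 (mvt e)).
have ch e : `|c e| <= `|h e| by rewrite /c; case: cid2.
have cE e : p (u e (w e + h e *: e_ k)) - p (u e (w e)) =
    p (partial k (u e) (w e + c e *: e_ k)) * h e.
  by rewrite /c; case: cid2 => /= t _ ->; rewrite pE.
pose z e := w e + c e *: e_ k.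
have zx e : enorm (z e - x e) <= enorm ((x - y) e).
  apply: enorm_mono => j; rewrite !mxE eqxx/= -val_eqE/= [X in _ <= X]distrC.
  case: (ltngtP j k) => [jk|jk|jk] /=; rewrite ?mulr0 ?addr0//.
    by rewrite subrr normr0.
  by rewrite mulr1 addrAC subrr add0r (ord_inj jk) (le_trans (ch e)).
have nzx : negligible (@enorm R d) (fun e => z e - x e).
  move=> m; apply: for_smallS (xy m) => e; exact: le_trans.
have mz : z \in @moderateR R d.
  have m1 : (fun e => z e - x e) \in @moderateR R d.
    apply/asboolP; exists 0; apply: for_smallS (nzx 0) => e.
    by rewrite expr0 invr1.
  have -> : z = (fun e => z e - x e) + x.
    by apply/funext => e; rewrite !fctE subrK.
  by rewrite rpredD//; exact: valP.
pose Z : M_R R d := MkM_R mz.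
have ZE : \pi_(Rtilde R d) Z = \pi_(Rtilde R d) x by apply/pi_RtildeP.
have AZ : A (\pi_(Rtilde R d) Z) by rewrite ZE.
have [N hN] := EM_moderate_partial u k AZ.
move=> m; apply: for_smallS (for_smallI hN (xy (m + N)%N)) => e [he1 he2].
rewrite wS cE normrM.
have e0 : epsv e != 0 by rewrite gt_eqF ?I01_gt0.
rewrite -[leRHS]mul1r -(@mulVf _ (epsv e ^+ N)) ?expf_neq0//.
rewrite -mulrA [_ ^+ N * _]mulrC -exprD ler_pM//.
  exact: le_trans (pn _) he1.
apply: le_trans he2; apply: (le_trans _ (coord_le_enorm _ k)).
by rewrite !mxE distrC.
Qed.

Lemma EM_eval_eq (u : E_M A) (x y : M_R R d) : A (\pi_(Rtilde R d) x) ->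
  \pi_(Rtilde R d) x = \pi_(Rtilde R d) y ->
  negligible (@normc R) (fun e => u e (x e) - u e (y e)).
Proof.
move=> Ax /pi_RtildeP xy.
have sm e : partially_derivable (u e) by exact/smooth_pd/EM_smooth.
have hyb k : (k <= d)%N -> negligible (@normc R) (fun e =>
    u e (hybrid (x e) (y e) k) - u e (x e)).
  elim: k => [_|k IH kd].
    rewrite (_ : (fun e => _) = 0); first exact: (negligible0 (normc0 R)).
    apply/funext => e; apply/eqP; rewrite subr_eq0; apply/eqP; congr (u e _).
    by apply/rowP => j; rewrite !mxE.
  have h1 := @step x y (Ordinal kd) u (@complex.Re R) Re_le_normc
    (fun e z => (let: And3 _ _ h := sm e in (h (Ordinal kd) z).1))
    (fun e z => erefl) Ax xy.
  have h2 := @step x y (Ordinal kd) u (@complex.Im R) Im_le_normc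
    (fun e z => (let: And3 _ _ h := sm e in (h (Ordinal kd) z).2))
    (fun e z => erefl) Ax xy.
  have h3 : negligible (@normc R) (fun e => u e (hybrid (x e) (y e) k.+1)
      - u e (hybrid (x e) (y e) k)).
    move=> m; apply: for_smallS (for_smallI (for_small_half R)
      (for_smallI (h1 m.+1) (h2 m.+1))) => e [e2 [he1 he2]].
    apply: (le_trans (normc_Re_Im _)); rewrite !raddfB.
    apply: (le_trans (lerD he1 he2)); rewrite -mulr2n -mulr_natl exprS mulrA.
    rewrite ler_piMl ?exprn_ge0 ?(ltW (I01_gt0 e))//.
    by rewrite -ler_pdivlMl// mulr1.
  have h4 : negligible (@normc R) (fun e => u e (x e)
      - u e (hybrid (x e) (y e) k)).
    move=> m; apply: for_smallS (IH (ltnW kd) m) => e.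
    by rewrite -normcN opprB.
  have := negligibleB (@normcB2 R) h3 h4.
  congr negligible; apply/funext => e; rewrite !fctE.
  by rewrite opprB addrA subrK.
move=> m; apply: for_smallS (hyb d (leqnn d) m) => e.
rewrite -normcN opprB; congr (normc (_ - u e _) <= _).
by apply/rowP => j; rewrite !mxE ltn_ord.
Qed.

Fact point_value_moderate (u : E_M A) (x : M_R R d) :
  A (\pi_(Rtilde R d) x) -> (fun e => u e (x e)) \in moderateC R.
Proof.
move=> Ax; apply/asboolP; have := EM_moderate u (fun=> 0%N) Ax.
by congr moderate; apply/funext => e; rewrite multi_partial0.
Qed.

Definition point_value_rep (u : E_M A) (x : M_R R d)
  (Ax : A (\pi_(Rtilde R d) x)) : M_C R := MkM_C (point_value_moderate u Ax).

Fact repr_in (xt : Rtilde R d) : A xt -> A (\pi_(Rtilde R d) (repr xt)).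
Proof. by rewrite reprK. Qed.

(* independent of the representatives by point_valueE *)
Definition point_value (u : Gtilde A) (xt : Rtilde R d) (Ax : A xt) :
  Ctilde R := \pi_(Ctilde R) (point_value_rep (repr u) (repr_in Ax)).

Lemma pi_CtildeP (a b : M_C R) :
  \pi_(Ctilde R) a = \pi_(Ctilde R) b <-> negligible (@normc R) (a - b).
Proof.
have -> : (\pi_(Ctilde R) a = \pi_(Ctilde R) b) <-> (a - b \in N_C R).
  split => [|h]; last by apply/eqP; rewrite piE /Quotient.equiv.
  by move/eqP; rewrite piE /Quotient.equiv.
by split=> [/asboolP|h]; last exact/asboolP.
Qed.

Lemma point_valueE (u : E_M A) (x : M_R R d) (Ax : A (\pi_(Rtilde R d) x)) :
  point_value (\pi_(Gtilde A) u) Ax = \pi_(Ctilde R) (point_value_rep u Ax).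
Proof.
apply/pi_CtildeP; set v := repr _; set y := repr _.
have yx : \pi_(Rtilde R d) y = \pi_(Rtilde R d) x by rewrite reprK.
have Ay : A (\pi_(Rtilde R d) y) by rewrite yx.
have uv : u - v \in @N_G R d A.
  have : \pi_(Gtilde A) u = \pi_(Gtilde A) v by rewrite reprK.
  by move/eqP; rewrite piE /Quotient.equiv.
have h1 : negligible (@normc R) (fun e => u e (x e) - v e (x e)).
  move/asboolP: uv => /(_ (fun=> 0%N) x Ax); congr negligible.
  by apply/funext => e; rewrite multi_partial0.
have h2 := EM_eval_eq v Ay yx.
move=> m; have h3 := negligibleB (@normcB2 R) h2 h1.
apply: for_smallS (h3 m) => e; congr (normc _ <= _).
by rewrite -[RHS]/(v e (y e) - u e (x e)) opprB addrA subrK.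
Qed.

End PointValues.

(* Main.v *)
(* If (3) fails, there are eps_n -> 0 and points x_n, within about eps_n^n of
   A_(eps_n), with |u_(eps_n)(x_n)| < eps_n^n; they are the values at the eps_n
   of a net representing a point of A at which u is not invertible.
   Conversely, under (3) the denominator D = |u|^2 + rho, where rho > 0 is a
   negligible net of constants, vanishes nowhere on R^d and is bounded below by
   a power of eps at the points of A.  Hence 1/D is smooth and moderate, and
   v = conj(u)/D satisfies u v = 1 - rho/D = 1 modulo negligible nets: no cutoff
   function is needed. *)
Require Import Defs.
From HB Require Import structures.
From mathcomp Require Import all_boot all_order all_algebra.
From mathcomp Require Import complex ring.
From mathcomp Require Import all_classical all_reals.
From mathcomp Require Import ereal topology normedtype derive exp.
Import numFieldNormedType.Exports.

Set Implicit Arguments.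
Unset Strict Implicit.
Unset Printing Implicit Defensive.
Import Order.TTheory GRing.Theory Num.Theory Normc.
Local Open Scope ring_scope.
Local Open Scope classical_set_scope.
Local Open Scope quotient_scope.

(** * Conjugates, reciprocals and iterated derivatives of smooth functions *)

Section SmoothFunctions.
Variables (R : realType) (d : nat).
Notation C := (R[i]).
Notation V := ('rV[R]_d).
Implicit Types (f g : V -> C) (i : 'I_d).

Definition conjf f : V -> C := fun x => (f x)^*%C.

Lemma Re_conjf f :
  (fun x => complex.Re (conjf f x)) = (fun x => complex.Re (f x)).
Proof. by apply/funext => x; rewrite /conjf; case: (f x). Qed.

Lemma Im_conjf f :
  (fun x => complex.Im (conjf f x)) = - (fun x => complex.Im (f x)).
Proof. by apply/funext => x; rewrite /conjf !fctE; case: (f x). Qed.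

Lemma normc_conj (z : C) : normc z^*%C = normc z.
Proof. by case: z => a b; rewrite /= sqrrN. Qed.

Lemma normc_ge0 (z : C) : 0 <= normc z.
Proof. by case: z => a b; exact: sqrtr_ge0. Qed.

Lemma partially_derivable_conjf f :
  partially_derivable f -> partially_derivable (conjf f).
Proof.
move=> [fr fi fd]; rewrite /partially_derivable Re_conjf Im_conjf.
split=> [|x|i x]; first exact: fr; first exact: cvgN (fi x).
by have [fR fI] := fd i x; split; [exact: fR|exact: derivableN].
Qed.

Lemma partial_conjf i f : partially_derivable f ->
  partial i (conjf f) = conjf (partial i f).
Proof.
move=> [_ _ fd]; apply/funext => x; rewrite /partial Re_conjf Im_conjf /conjf.
by rewrite deriveN//; have [] := fd i x.
Qed.

Lemma smooth_conjf f : smooth f -> smooth (conjf f).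
Proof.
move=> /smoothnP sf; apply/smoothnP => n; have {sf} := sf n.
elim: n f => [|n IH] f; first exact: partially_derivable_conjf.
move=> [df sf]; split; first exact: partially_derivable_conjf.
by move=> i; rewrite partial_conjf//; exact/IH/sf.
Qed.

Lemma partials_conjf s a f : smooth f ->
  partials s a (conjf f) = conjf (partials s a f).
Proof.
move=> sf; elim: s => [//|i s IH] /=; rewrite IH.
elim: (a i) => [//|k IHk] /=; rewrite IHk partial_conjf//.
exact/smooth_pd/smooth_iter/smooth_partials.
Qed.

Definition recf f : V -> C := fun x => (f x)^-1.

Lemma recfM f : (forall x, f x != 0) -> recf f * f = cst 1.
Proof. by move=> f0; apply/funext => x; rewrite !fctE /recf mulVf. Qed.

(** Writing [f = a + i b], the reciprocal is [(a - i b) / (a ^+ 2 + b ^+ 2)], which reduces the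
    claim to real quotients with nonvanishing denominator. *)
Lemma partially_derivable_recf f : (forall x, f x != 0) ->
  partially_derivable f -> partially_derivable (recf f).
Proof.
move=> f0 [fr fi fd].
pose a x := complex.Re (f x); pose b x := complex.Im (f x).
pose n := a * a + b * b.
have n0 x : n x != 0.
  rewrite /n /a /b !fctE -!expr2; have := f0 x; case: (f x) => p q /=.
  rewrite paddr_eq0 ?sqr_ge0// !sqrf_eq0; apply: contra => /andP[/eqP-> /eqP->].
  exact: eqxx.
have nc x : {for x, continuous n}.
  exact: (cvgD (cvgM (fr x) (fr x)) (cvgM (fi x) (fi x))).
have nd i x : derivable n x (delta_mx 0 i).
  have [fR fI] := fd i x.
  exact: (derivableD (derivableM fR fR) (derivableM fI fI)).
pose m x := (n x)^-1.
have mc x : {for x, continuous m} by exact: continuousV.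
have md i x : derivable m x (delta_mx 0 i) by exact: derivableV.
have rE : (fun x => complex.Re (recf f x)) = a * m.
  apply/funext => x; rewrite /recf /m /n /a /b !fctE.
  by case: (f x) => p q; rewrite -!expr2.
have iE : (fun x => complex.Im (recf f x)) = - (b * m).
  apply/funext => x; rewrite /recf /m /n /a /b !fctE.
  by case: (f x) => p q; rewrite -!expr2.
rewrite /partially_derivable rE iE; split=> [x|x|i x].
- exact: (cvgM (fr x) (mc x)).
- exact: (cvgN (cvgM (fi x) (mc x))).
- have [fR fI] := fd i x; split; first exact: (derivableM fR (md i x)).
  exact: (derivableN (derivableM fI (md i x))).
Qed.

(** Differentiate [recf f * f = 1] by the product rule and cancel the nonzero factor [f x]. The
    product form lets the Leibniz rule be applied again to the result. *)
Lemma partial_recf i f : (forall x, f x != 0) -> partially_derivable f ->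
  partial i (recf f) = (recf f * recf f) * (- partial i f).
Proof.
move=> f0 df; have dg := partially_derivable_recf f0 df.
have := partialM i dg df; rewrite recfM// partial_cst => h.
apply/funext => x; have := congr1 (fun k => k x) h; rewrite !fctE /= => {}h.
have ga : recf f x * f x = 1 by rewrite /recf mulVf.
apply: (mulIf (f0 x)); rewrite mulrN mulNr mulrAC -(mulrA (recf f x)) ga mulr1.
by rewrite -mulNr; apply/eqP; rewrite -subr_eq0 h.
Qed.

Lemma smooth_recf f : (forall x, f x != 0) -> smooth f -> smooth (recf f).
Proof.
move=> f0 sf; have df := smooth_pd sf; apply/smoothnP; elim=> [|n IH].
  exact: partially_derivable_recf.
split=> [|i]; first exact: partially_derivable_recf.
rewrite partial_recf//; apply: smoothnM; first exact: smoothnM.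
by apply: smoothnN; have /smoothnP := smooth_partial i sf; apply.
Qed.

(** A word records the order of differentiation; its last letter is the innermost derivative, so
    inductions remove letters from the right. *)
Definition dword (s : seq 'I_d) f : V -> C := foldr (@partial R d) f s.

Lemma smooth_dword s f : smooth f -> smooth (dword s f).
Proof.
by move=> sf; elim: s => [|i s IH]; [exact: sf|exact: smooth_partial].
Qed.

Lemma dword_rcons s i f : dword (rcons s i) f = dword s (partial i f).
Proof. exact: foldr_rcons. Qed.

Lemma dwordB s f g : smooth f -> smooth g ->
  dword s (f - g) = dword s f - dword s g.
Proof.
move=> sf sg; elim: s => [//|i s IH] /=.
by rewrite IH partialB; [|exact/smooth_pd/smooth_dword..].
Qed.

Lemma dwordN s f : smooth f -> dword s (- f) = - dword s f.
Proof.
move=> sf; rewrite -[in LHS](sub0r f) dwordB; [|exact: smooth_cst|exact: sf].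
suff -> : dword s 0 = 0 by rewrite sub0r.
by elim: s => [|i s IH] /=; [|rewrite IH; exact: partial_cst].
Qed.

Definition word (s : seq 'I_d) (a : 'I_d -> nat) : seq 'I_d :=
  flatten [seq nseq (a i) i | i <- s].

Lemma partials_word s a f : partials s a f = dword (word s a) f.
Proof.
elim: s => [//|i s IH]; rewrite /= IH /dword foldr_cat.
by elim: (a i) => //= k ->.
Qed.

(* [E_M] only controls derivatives taken in the fixed order of
   [multi_partial]; the words for these are stable under subsequences, so the
   Leibniz rule never requires partial derivatives to commute. *)
Lemma subseq_word s a t : uniq s -> subseq t (word s a) ->
  exists b, t = word s b.
Proof.
elim: s t => [[] // _ _|i s IH t /= /andP[si us]]; first by exists a.
case/subseqP => m sm ->.
have szm : (size (take (a i) m) = size (nseq (a i) i))%N.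
  by rewrite size_nseq size_takel// sm size_cat size_nseq leq_addr.
(* The mask is cut after the block of letters [i]: its first part acts on that block, its second
   part on the word of the remaining indices. *)
rewrite -(cat_take_drop (a i) m) mask_cat//.
have [|b bE] := IH (mask (drop (a i) m) (word s a)) us.
  exact: mask_subseq.
(* The new exponent of [i] is the number of letters kept in its block; [uniq] ensures that changing
   it leaves the word over [s] unaffected. *)
rewrite bE; exists (fun j => if j == i then
  size (mask (take (a i) m) (nseq (a i) i)) else b j); rewrite /word /= eqxx.
congr (_ ++ flatten _).
  by apply/all_pred1P/allP => j /mem_mask; rewrite mem_nseq => /andP[_].
apply/eq_in_map => j js; case: eqP => // ji.
by move: js; rewrite ji (negbTE si).
Qed.

End SmoothFunctions.

(** * Stability of a class of nets under derivatives of products and reciprocals *)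

Section Words.
Variables (R : realType) (d : nat).
Notation I := (I01 R).
Notation C := (R[i]).
Notation V := ('rV[R]_d).
Implicit Types u v : I -> V -> C.
Variable S : (I -> C) -> Prop.
Hypothesis SB : forall a b, S a -> S b -> S (a - b).
Hypothesis SM : forall a b, S a -> S b -> S (a * b).
Variable x : I -> V.

(** Subsequences are included because the product rule distributes the letters of a word between the
    factors. *)
Let along s u := forall t, subseq t s -> S (fun e => dword t (u e) (x e)).

Let along_sub s t u : subseq t s -> along s u -> along t u.
Proof. by move=> ts h r rt; apply: h; exact: subseq_trans ts. Qed.

Let along_rcons s i u : along (rcons s i) u ->
  along s u /\ along s (fun e => partial i (u e)).
Proof.
move=> h; split; first by apply: along_sub h; exact: subseq_rcons.
move=> t ts; have := h (rcons t i); rewrite -!cats1 subseq_cat2r => /(_ ts).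
by congr S; apply/funext => e; rewrite cats1 dword_rcons.
Qed.

Let SN a : S a -> S (- a).
Proof. by move=> Sa; have := SB (SB Sa Sa) Sa; rewrite subrr sub0r. Qed.

Let alongN s u : (forall e, smooth (u e)) -> along s u ->
  along s (fun e => - u e).
Proof.
move=> su h t /h /SN; congr S; apply/funext => e; rewrite dwordN//.
Qed.

(** Induction on the innermost derivative: the product rule in the form
    [partial i u * v - (- u) * partial i v] leaves two products to be differentiated along a shorter
    word. *)
Lemma dword_mul s u v : (forall e, smooth (u e)) -> (forall e, smooth (v e)) ->
  (forall t, subseq t s -> S (fun e => dword t (u e) (x e))) ->
  (forall t, subseq t s -> S (fun e => dword t (v e) (x e))) ->
  S (fun e => dword s (u e * v e) (x e)).
Proof.
elim/last_ind: s u v => [|s i IH] u v su sv hu hv.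
  exact: SM (hu [::] isT) (hv [::] isT).
have [hu0 hui] := along_rcons hu; have [hv0 hvi] := along_rcons hv.
have su' e : smooth (partial i (u e)) by exact: smooth_partial.
have sv' e : smooth (partial i (v e)) by exact: smooth_partial.
have sN e : smooth (- u e) by exact: smoothN.
have := SB (IH _ _ su' sv hui hv0) (IH _ _ sN sv' (alongN su hu0) hvi).
congr S; apply/funext => e; rewrite dword_rcons partialM; [|exact: smooth_pd..].
by rewrite dwordB//; exact: smoothM.
Qed.

(** Strong induction on the length of the word: by [partial_recf], the innermost derivative of [1/u]
    is [(1/u)^2] times [- partial i u], and there [1/u] is differentiated only along shorter
    words. *)
Lemma dword_inv s u : (forall e, smooth (u e)) -> (forall e y, u e y != 0) ->
  (forall t, subseq t s -> S (fun e => dword t (u e) (x e))) ->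
  S (fun e => (u e (x e))^-1) ->
  S (fun e => dword s (recf (u e)) (x e)).
Proof.
move=> su u0 hu hx; have sr e : smooth (recf (u e)) by exact: smooth_recf.
have [n] := ubnP (size s); elim: n s hu => // n IH s.
elim/last_ind: s => [//|s i _] hu.
rewrite size_rcons ltnS => sn.
have [hu0 hui] := along_rcons hu.
have hr t : subseq t s -> S (fun e => dword t (recf (u e)) (x e)).
  move=> ts; apply: IH; first exact: along_sub hu0.
  exact: leq_ltn_trans (size_subseq ts) sn.
have hrr t : subseq t s -> S (fun e => dword t (recf (u e) * recf (u e)) (x e)).
  by move=> ts; apply: dword_mul => // r rt; apply: hr; exact: subseq_trans ts.
have su' e : smooth (partial i (u e)) by exact: smooth_partial.
have sN e : smooth (- partial i (u e)) by exact: smoothN.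
have srr e : smooth (recf (u e) * recf (u e)) by exact: smoothM.
have := dword_mul srr sN hrr (alongN su' hui).
congr S; apply/funext => e; rewrite dword_rcons partial_recf//.
exact: smooth_pd.
Qed.

End Words.

(** * Small parameters, and moderate and negligible nets of numbers *)

Section SmallParameters.
Variable R : realType.
Notation I := (I01 R).
Notation C := (R[i]).

Lemma for_small_lt (c : R) : 0 < c -> for_small (fun e : I => epsv e < c).
Proof.
move=> c0; have h : 0 < Num.min (c / 2) 2^-1 < 1.
  rewrite lt_min divr_gt0// invr_gt0 ltr0n gt_min.
  by rewrite invf_lt1 ?ltr1n ?ltr0n ?orbT.
exists (MkI01 h) => e /= ec; apply: (le_lt_trans ec).
by rewrite gt_min ltr_pdivrMr// ltr_pMr// ltr1n.
Qed.


(* The exponent tends to infinity as [e] tends to 0, so this net is positive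
   and negligible. *)
Definition flat (e : I) : R := epsv e ^+ Num.truncn (epsv e)^-1.

Lemma flat_gt0 e : 0 < flat e.
Proof. by rewrite exprn_gt0 ?I01_gt0. Qed.

Lemma negligible_flat : negligible (@normc R) (fun e => (flat e)%:C%C).
Proof.
(* Once [epsv e < 1/(m+1)], the exponent in [flat e] is at least [m+1], hence at least [m]. *)
move=> m; have m0 : 0 < (m.+1%:R : R)^-1 by rewrite invr_gt0.
apply: for_smallS (for_small_lt m0) => e em; have e0 := I01_gt0 e.
rewrite /= expr0n addr0 sqrtr_sqr gtr0_norm ?flat_gt0// expI01_le//.
rewrite truncn_ge_nat ?invr_ge0 ?(ltW e0)// (@le_trans _ _ m.+1%:R) ?ler_nat//.
by rewrite -[_.+1%:R]invrK lef_pV2 ?posrE// ltW.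
Qed.

Lemma negligible_moderate (E : Type) (nm : E -> R) (x : I -> E) :
  negligible nm x -> moderate nm x.
Proof.
by move=> hx; exists 0; apply: for_smallS (hx 0) => e; rewrite expr0 invr1.
Qed.

Lemma moderateM (a b : I -> C) : moderate (@normc R) a ->
  moderate (@normc R) b -> moderate (@normc R) (a * b).
Proof.
move=> ha hb.
have ma : a \in moderateC R by exact/asboolP.
have mb : b \in moderateC R by exact/asboolP.
by have /asboolP := rpredM ma mb.
Qed.

End SmallParameters.

(** * Inverses of generalized functions and of their point values *)

Section ModerateFunctions.
Variables (R : realType) (d : nat) (A : set (Rtilde R d)).
Notation I := (I01 R).
Notation C := (R[i]).

Fact conjf_moderate (u : E_M A) : (fun e => conjf (u e)) \in moderateG A.
Proof.
apply/asboolP; split=> [e|a x Ax]; first exact/smooth_conjf/EM_smooth.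
have := EM_moderate u a Ax; rewrite /moderate.
move=> [N h]; exists N; apply: for_smallS h => e.
by rewrite /multi_partial partials_conjf ?normc_conj//; exact: EM_smooth.
Qed.

Lemma normc_partials_cst s a (c : C) (x : 'rV[R]_d) :
  normc (partials s a (cst c) x) <= normc c.
Proof.
have [c' [-> h]] := partials_cst s a c.
case: h => ->; first exact: lexx.
by rewrite [X in X <= _](normc0 R) normc_ge0.
Qed.

Fact cst_moderate (c : I -> C) : moderate (@normc R) c ->
  (fun e => cst (c e)) \in moderateG A.
Proof.
move=> [N h]; apply/asboolP; split=> [e|a x Ax]; first exact: smooth_cst.
exists N; apply: for_smallS h => e; apply: le_trans.
exact: normc_partials_cst.
Qed.

(** Bounds on the values of [1/u] propagate to all its derivatives by [dword_inv], since
    subsequences of the words of [multi_partial] are again such words. *)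
Fact recf_moderate (u : E_M A) : (forall e y, u e y != 0) ->
  (forall x : M_R R d, A (\pi_(Rtilde R d) x) ->
    moderate (@normc R) (fun e => (u e (x e))^-1)) ->
  (fun e => recf (u e)) \in moderateG A.
Proof.
move=> u0 hu; apply/asboolP; split=> [e|a x Ax].
  by apply: smooth_recf => //; exact: EM_smooth.
have := @dword_inv R d (moderate (@normc R)) (moderateB (@normcB2 R))
  (@moderateM R) x (word (enum 'I_d) a) u (@EM_smooth _ _ _ u) u0.
under [X in _ -> _ -> moderate _ X]eq_fun do rewrite -partials_word.
apply; last exact: hu.
move=> t /subseq_word[|b ->]; first exact: enum_uniq.
have := EM_moderate u b Ax; congr moderate; apply/funext => e.
by rewrite /multi_partial partials_word.
Qed.

(** The exponent may depend on the net [x], because moderateness is tested on one net at a time. *)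
Lemma lower_bound_invertible (u : E_M A) :
  (forall x : M_R R d, A (\pi_(Rtilde R d) x) ->
    exists n : nat, for_small (fun e => epsv e ^+ n <= normc (u e (x e)))) ->
  exists v : Gtilde A, \pi_(Gtilde A) u * v = 1.
Proof.
move=> hu; pose cu : E_M A := MkE_M (conjf_moderate u).
pose r : E_M A :=
  MkE_M (cst_moderate (negligible_moderate (@negligible_flat R))).
pose D : E_M A := u * cu + r.
have normD e y : normc (D e y) = normc (u e y) ^+ 2 + flat e.
  rewrite -[D e y]/(u e y * (u e y)^*%C + (flat e)%:C%C).
  case: (u e y) => a b /=; rewrite sqr_sqrtr ?addr_ge0 ?sqr_ge0//.
  have -> : a * - b + b * a + 0 = 0 by ring.
  have -> : a * a - b * - b + flat e = a ^+ 2 + b ^+ 2 + flat e by ring.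
  rewrite expr0n addr0 sqrtr_sqr ger0_norm// !addr_ge0 ?sqr_ge0//.
  exact/ltW/flat_gt0.
have D0 e y : D e y != 0.
  apply: contraTneq (flat_gt0 e) => Dy; have := normD e y.
  rewrite Dy (normc0 R) => h; rewrite -leNgt.
  by rewrite -(lerD2l (normc (u e y) ^+ 2)) -h addr0 sqr_ge0.
have Dm (x : M_R R d) : A (\pi_(Rtilde R d) x) ->
    moderate (@normc R) (fun e => (D e (x e))^-1).
  (* The exponent doubles because [D] is bounded below by the square of [|u|]. *)
  move=> /hu[n hn]; exists (n * 2)%N; apply: for_smallS hn => e he.
  rewrite normcV normD; have e0 := I01_gt0 e.
  have le2 : epsv e ^+ (n * 2) <= normc (u e (x e)) ^+ 2.
    by rewrite exprM lerXn2r ?nnegrE ?normc_ge0 ?exprn_ge0 ?(ltW e0).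
  rewrite lef_pV2 ?posrE ?exprn_gt0//; last first.
    by rewrite ltr_wpDl ?sqr_ge0 ?flat_gt0.
  by rewrite (le_trans le2)// lerDl (ltW (flat_gt0 e)).
pose w : E_M A := MkE_M (recf_moderate D0 Dm).
have Dw : D * w = 1.
  apply: val_inj; apply/funext => e; apply/funext => y.
  exact: (mulfV (D0 e y)).
have rN : r \in @N_G R d A.
  apply/asboolP => a x Ax m; apply: for_smallS (@negligible_flat R m) => e.
  by apply: le_trans; exact: normc_partials_cst.
exists (\pi_(Gtilde A) (cu * w)).
rewrite -(pi_quotM (@NG_absorbing R d A)).
apply: (eq_trans _ (pi_one (@NG_absorbing R d A))).
(* Since [u * cu = D - r] and [D * w = 1], the defect is [- (r * w)], which lies in the ideal
   because [r] does. *)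
apply/pi_eqP; rewrite mulrA -[u * cu](addrK r) -/D mulrBl Dw.
by rewrite addrAC subrr sub0r rpredN mulrC NG_absorbing.
Qed.

Lemma invertible_point_value (u : E_M A) (v : Gtilde A) :
  \pi_(Gtilde A) u * v = 1 ->
  forall (xt : Rtilde R d) (Ax : A xt),
    exists y : Ctilde R, point_value (\pi_(Gtilde A) u) Ax * y = 1.
Proof.
elim/quotW: v => v uv; elim/quotW => x Ax.
exists (\pi_(Ctilde R) (point_value_rep v Ax)); rewrite point_valueE.
rewrite -(pi_quotM (@NC_absorbing R)).
apply: (eq_trans _ (pi_one (@NC_absorbing R))); apply/pi_CtildeP.
move: uv; rewrite -(pi_quotM (@NG_absorbing R d A)).
move=> /(fun h => eq_trans h (esym (pi_one (@NG_absorbing R d A)))).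
move=> /pi_eqP /asboolP /(_ (fun=> 0%N) x Ax); congr negligible.
by apply/funext => e; rewrite multi_partial0.
Qed.

(** Invertibility is brought down to nets, at an arbitrary representative [x], so that it can be
    tested on a net built by hand. *)
Lemma point_value_invertible (u : E_M A) (x : M_R R d)
    (Ax : A (\pi_(Rtilde R d) x)) :
  (exists y : Ctilde R, point_value (\pi_(Gtilde A) u) Ax * y = 1) ->
  exists2 b : I -> C, moderate (@normc R) b &
    negligible (@normc R) (fun e => u e (x e) * b e - 1).
Proof.
case; elim/quotW => b; rewrite point_valueE -(pi_quotM (@NC_absorbing R)).
move=> /(fun h => eq_trans h (esym (pi_one (@NC_absorbing R)))).
by move=> /pi_CtildeP h; exists b => //; have /asboolP := valP b.
Qed.

End ModerateFunctions.

(** * From pointwise invertibility to a uniform lower bound *)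

Section InternalSets.
Variables (R : realType) (d : nat) (Ae : I01 R -> set 'rV[R]_d).
Notation I := (I01 R).
Notation C := (R[i]).
Notation V := ('rV[R]_d).

(** A representative of a point need not take values in [Ae e], but it differs by a negligible net
    from one that does for small [e]. *)
Lemma internal_set_enlarge (x : M_R R d) (n : nat) :
  internal_set Ae (\pi_(Rtilde R d) x) ->
  for_small (fun e => enlarge (Ae e) (epsv e ^+ n) (x e)).
Proof.
move=> [y [/pi_RtildeP xy hy]].
apply: for_smallS (for_smallI hy (xy n)) => e [Ay xyn].
apply: (@le_trans _ _ (enorm (x e - y e))%:E); last by rewrite lee_fin.
by apply: ereal_inf_lbound; exists (y e).
Qed.

Lemma sharply_bounded_rep_moderate (y : I -> V) : sharply_bounded_rep Ae ->
  for_small (fun e => Ae e (y e)) -> moderate (@enorm R d) y.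
Proof.
move=> [M hM] hy; exists M; apply: for_smallS (for_smallI hM hy) => e [hs Ay].
by rewrite -lee_fin; apply: le_trans hs; apply: ereal_sup_ubound; exists (y e).
Qed.

(** The distance to [Ae e] need not be attained; the factor 2 leaves room to choose an actual point
    [y] of [Ae e]. *)
Lemma le_ereal_inf_normc (f : V -> C) e n :
  (forall x y, Ae e y -> enorm (x - y) <= 2 * epsv e ^+ n ->
     epsv e ^+ n <= normc (f x)) ->
  ((epsv e ^+ n)%:E <=
    ereal_inf [set (normc (f x))%:E | x in enlarge (Ae e) (epsv e ^+ n)])%E.
Proof.
move=> h; rewrite leNgt; apply/negP => /ereal_inf_lt[_ [x xA <-]].
rewrite lte_fin ltNge => /negP; apply.
have e0 : 0 < epsv e ^+ n by rewrite exprn_gt0 ?I01_gt0.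
have : (edist_set x (Ae e) < (2 * epsv e ^+ n)%:E)%E.
  by apply: le_lt_trans xA _; rewrite lte_fin ltr_pMl// ltr1n.
by move=> /ereal_inf_lt[_ [y yA <-]]; rewrite lte_fin => /ltW; exact: h.
Qed.

Lemma uniform_lower_bound (u : I -> V -> C) :
  internal_set Ae !=set0 -> sharply_bounded_rep Ae ->
  (forall x : M_R R d, internal_set Ae (\pi_(Rtilde R d) x) ->
    exists2 b : I -> C, moderate (@normc R) b &
      negligible (@normc R) (fun e => u e (x e) * b e - 1)) ->
  exists (e0 : I) (n : nat), forall e : I, epsv e <= epsv e0 ->
    ((epsv e ^+ n)%:E <=
      ereal_inf [set (normc (u e x))%:E | x in enlarge (Ae e) (epsv e ^+ n)])%E.
Proof.
move=> [_ [x0 [_ Ax0]]] Abnd hu; apply: contrapT => H.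
(* Failure of the bound for exponent [n] below the threshold [1/(n+2)], a number in (0,1) even for
   [n = 0], yields a parameter, a bad point and a nearby point of [Ae]. *)
have /choice[t tP] n : exists t : I * V * V,
    [/\ epsv t.1.1 <= n.+2%:R^-1, Ae t.1.1 t.2,
        enorm (t.1.2 - t.2) <= 2 * epsv t.1.1 ^+ n &
        normc (u t.1.1 t.1.2) < epsv t.1.1 ^+ n].
  have h : 0 < (n.+2%:R^-1 : R) < 1 by rewrite invr_gt0 ltr0n invf_lt1 ?ltr1n.
  apply: contrapT => nt; apply: H; exists (MkI01 h), n => e en.
  apply: le_ereal_inf_normc => x y Ay xy; rewrite leNgt; apply/negP => ue.
  by apply: nt; exists (e, x, y); split.
pose es n := (t n).1.1; pose xs n := (t n).1.2; pose ys n := (t n).2.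
have /choice[k kP] (e : I) : exists o : option nat,
    if o is Some n then es n = e else forall n, es n <> e.
  have [[n en]|ne] := pselect (exists n, es n = e); first by exists (Some n).
  by exists None => n en; apply: ne; exists n.
(* The [es n] need not be distinct; all that matters is that the index chosen
   by [k] tends to infinity as [e] tends to 0. *)
have k_large m : for_small (fun e => forall n, k e = Some n -> (m <= n)%N).
  elim: m => [|m IH]; first exact: for_smallS (for_small_half R).
  apply: for_smallS (for_smallI IH (for_small_lt (I01_gt0 (es m)))).
  move=> e [h em] n kn; have := h n kn; rewrite leq_eqVlt => /orP[/eqP mn|//].
  by have := kP e; rewrite kn -mn => eE; rewrite eE ltxx in em.
(* Off the sequence [es] both nets take the values of [x0], which lie in [Ae e] for small [e]. *)
pose x e := if k e is Some n then xs n else x0 e.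
pose y e := if k e is Some n then ys n else x0 e.
have yA : for_small (fun e => Ae e (y e)).
  apply: for_smallS Ax0 => e; rewrite /y; case: (k e) (kP e) => [n <- _|//].
  by have [] := tP n.
have xy : negligible (@enorm R d) (fun e => x e - y e).
  (* The extra power in [m.+1], with [epsv e <= 1/2], absorbs the factor 2 in the distance from
     [xs n] to [ys n]. *)
  move=> m; apply: for_smallS (for_smallI (for_small_half R) (k_large m.+1)).
  move=> e [e2 kl]; have e0 := I01_gt0 e; rewrite /x /y.
  case: (k e) (kP e) kl => [n en /(_ n erefl) mn|_ _]; last first.
    by rewrite subrr enorm0 exprn_ge0// ltW.
  have [_ _ + _] := tP n; rewrite -/(es n) -/(xs n) -/(ys n) en => /le_trans.
  apply; apply: (@le_trans _ _ (2 * epsv e ^+ m.+1)).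
    by rewrite ler_pM2l// expI01_le.
  by rewrite exprS mulrA ler_piMl ?exprn_ge0 ?(ltW e0)// -ler_pdivlMl// mulr1.
have my : y \in @moderateR R d by exact/asboolP/sharply_bounded_rep_moderate.
have mx : x \in @moderateR R d.
  have -> : x = (fun e => x e - y e) + y.
    by apply/funext => e; rewrite !fctE subrK.
  by rewrite rpredD//; apply/asboolP/negligible_moderate.
have /hu[b [N hN] /(_ 2) ub] : internal_set Ae (\pi_(Rtilde R d) (MkM_R mx)).
  by exists (MkM_R my); split=> //; apply/pi_RtildeP.
(* For an index at least [N + 2], the bounds [epsv e ^+ (N + 2)] on [u] and [epsv e ^- N] on [b]
   give a product of size at most [epsv e ^+ 2], too small to be within [epsv e ^+ 2] of 1. *)
have [e0 {}hN] := for_smallI (for_smallI (for_small_half R) (k_large (N + 2)%N))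
  (for_smallI hN ub).
have [n n0] : exists n : nat, (epsv e0)^-1 <= n.+2%:R.
  exists (Num.truncn (epsv e0)^-1); apply/ltW/(lt_trans (truncnS_gt _)).
  by rewrite ltr_nat.
have [le_n _ _ _] := tP n.
have /hN : epsv (es n) <= epsv e0.
  by rewrite (le_trans le_n)// -[leRHS]invrK lef_pV2 ?posrE ?invr_gt0 ?I01_gt0.
(* The index [n'] selected at [es n] may differ from [n]; it still satisfies [es n' = es n] and is
   at least [N + 2]. *)
have : k (es n) <> None by move=> kn; have := kP (es n); rewrite kn => /(_ n).
move: (es n) => e; rewrite /= /x; case: (k e) (kP e) => [n' en' _|//].
move=> [[e2 /(_ n' erefl) Nn'] [bN ub2]].
have := tP n'; rewrite -/(es n') -/(xs n') en' => -[_ _ _ un'].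
have eg0 := I01_gt0 e.
have e4 : epsv e ^+ 2 < 2^-1.
  rewrite expr2 (@le_lt_trans _ _ (2^-1 * 2^-1))//.
    by rewrite ler_pM// ltW.
  by rewrite gtr_pMl ?invr_gt0// invf_lt1 ?ltr1n.
have un2 : normc (u e (xs n') * b e) <= epsv e ^+ 2.
  rewrite normcM (@le_trans _ _ (epsv e ^+ (N + 2) * epsv e ^- N))//.
    rewrite ler_pM ?normc_ge0//.
    by rewrite (le_trans (ltW un'))// expI01_le.
  by rewrite addnC exprD mulfK// expf_neq0 ?gt_eqF.
suff : normc (1 : C) < 1 by rewrite (normc1 R) ltxx.
(* Here 1 is split as [u b - (u b - 1)], and each term has modulus below 1/2. *)
rewrite -[X in normc X](subKr (u e (xs n') * b e)).
rewrite (le_lt_trans (le_normcD _ _))// normcN.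
rewrite [ltRHS](_ : _ = 2^-1 + 2^-1); last by field.
by rewrite ltrD// (le_lt_trans _ e4).
Qed.

End InternalSets.

(** * The cycle of implications between the three conditions *)

Theorem proposition3p19 (R : realType) (d : nat) (A : set (Rtilde R d))
    (A_neq0 : A !=set0) (A_internal : internal A)
    (A_bounded : sharply_bounded A)
    (u : Gtilde A) (ue : E_M A) (u_rep : u = \pi_(Gtilde A) ue)
    (Ae : I01 R -> set 'rV[R]_d) (A_rep : A = internal_set Ae)
    (Ae_bounded : sharply_bounded_rep Ae) :
  [<-> exists v : Gtilde A, u * v = 1;
       forall (xt : Rtilde R d) (Axt : A xt),
         exists y : Ctilde R, point_value u Axt * y = 1;
       exists (e0 : I01 R) (n : nat), forall e : I01 R, epsv e <= epsv e0 ->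
         ((epsv e ^+ n)%:E <=
          ereal_inf [set (Normc.normc (ue e x))%:E |
                      x in enlarge (Ae e) (epsv e ^+ n)])%E].
Proof.
rewrite {u}u_rep; tfae.
- by move=> [v uv]; exact: invertible_point_value uv.
- move=> h; apply: uniform_lower_bound => //; first by rewrite -A_rep.
  by move=> x; rewrite -A_rep => Ax; apply: point_value_invertible; exact: h Ax.
move=> [e0 [n hn]]; apply: lower_bound_invertible => x; rewrite {1}A_rep => Ax.
(* The same [n] serves as radius and as bound: every representative eventually enters the enlarged
   set on which the infimum is taken. *)
exists n; apply: for_smallS (for_smallI (ex_intro _ e0 hn)
  (internal_set_enlarge n Ax)) => e [he xe].
by rewrite -lee_fin (le_trans he)//; apply: ereal_inf_lbound; exists (x e).
Qed.
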